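(* Let $d=1$. If $u:[0,T]\times\Omega\to\mathbb{R}$ is a viscosity subsolution of the terminal value problem $$\partial_tu+\inf_{a\in A}\Big[b(t,\mathbf{x},a)\,\partial_{\mathbf{x}}u+\tfrac12\sigma^2(t,\mathbf{x},a)\,\partial^2_{\mathbf{x}\mathbf{x}}u\Big]=0\ \text{ on }[0,T)\times\Omega,\qquad u(T,\mathbf{x})=h(\mathbf{x})\ \text{ on }\Omega,$$ then $u$ is a quasi-contingent subsolution of this terminal value problem.
   Context: Setting ($d=1$). Fix $T\in(0,\infty)$. $\Omega=C(\mathbb{R}_+,\mathbb{R})$, $\mathbb{P}$ is Wiener measure on $\mathcal{B}(\Omega)$ with expectation $\mathbb{E}$, $W_t(\omega)=\omega(t)$ is the canonical process, $\mathbb{F}=(\mathcal{F}_t)_{t\ge0}$, $\mathcal{F}_t=\sigma(W_s:0\le s\le t)$. For $t\ge 0$, $\mathbb{F}^t=(\mathcal{F}^t_s)_s$ with $\mathcal{F}^t_s=\sigma(W_r-W_t:t\le r\le s)$ for $s\ge t$ and $\mathcal{F}^t_s=\{\emptyset,\Omega\}$ for $s<t$. $\mathbb{L}^0(\mathbb{F}^t,\mathbb{R})$ is the set of real $\mathbb{F}^t$-progressive processes on $\mathbb{R}_+\times\Omega$; $\mathbb{L}^2(\mathbb{F}^t,\mathbb{P},\mathbb{R})$ is the set of $X\in\mathbb{L}^0(\mathbb{F}^t,\mathbb{R})$ with $\|X\|^2_{\mathbb{L}^2(\mathbb{F}^t,\mathbb{P},\mathbb{R})}:=\mathbb{E}[\int_t^\infty|X_s|^2ds]<\infty$.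 $\llbracket\tau_1,\tau_2\rrbracket=\{(s,\omega):\tau_1(\omega)\le s\le\tau_2(\omega)\}$. Subsets of $\mathbb{R}_+\times\Omega$ carry the pseudo-metric $|t-t'|+\|\mathbf{x}_{\cdot\wedge t}-\mathbf{x}'_{\cdot\wedge t'}\|_\infty$; (semi)continuity is with respect to it (so semicontinuous functions are non-anticipating). Data and standing assumptions. $A$ is a Borel subset of $[0,1]$; $(a^\circ,p^\circ,q^\circ)\in A\times\mathbb{R}\times\mathbb{R}$ is fixed. $b,\sigma:\mathbb{R}_+\times\Omega\times A\to\mathbb{R}$, $h:\Omega\to\mathbb{R}$ satisfy: (A1) $h$ is $\mathcal{F}_T$-measurable, $b,\sigma$ are Borel measurable, $(b,\sigma)(t,\mathbf{x},a)=\mathbf{1}_{[0,T]}(t)\,(b,\sigma)(t,\mathbf{x}_{\cdot\wedge t},a)$, $h(\mathbf{x})=h(\mathbf{x}_{\cdot\wedge T})$; (A2) there is $L_b\ge1$ with $|b(t,\mathbf{x},a)-b(t,\tilde{\mathbf{x}},a)|+|\sigma(t,\mathbf{x},a)-\sigma(t,\tilde{\mathbf{x}},a)|\le L_b\|\mathbf{x}_{\cdot\wedge t}-\tilde{\mathbf{x}}_{\cdot\wedge t}\|_\infty$ and $|b(t,\mathbf{x},a)|+|\sigma(t,\mathbf{x},a)|+|h(\mathbf{x})|\le L_b$ for all arguments. Controls. $\mathcal{A}$ is the set of $\mathbb{F}$-predictable $a:\mathbb{R}_+\times\Omega\to A$; $\mathcal{A}^t$ is the set of $a\in\mathcal{A}$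 that are $\mathbb{F}^t$-predictable with $a|_{\llbracket0,t\rrbracket}=a^\circ$. By convention, every pair in $\mathbb{L}^2(\mathbb{F}^t,\mathbb{P},\mathbb{R})^2$ equals $(p^\circ,q^\circ)$ on $\llbracket0,t\rrbracket$ (values before $t$ play no role). Processes. $X=X^{t,\mathbf{x};\beta,\varsigma;p,q}$ is given by $X_s=\mathbf{x}_s$ on $[0,t]$ and $X_s=\mathbf{x}_t+\int_t^s[\beta_r+p_r]dr+\int_t^s[\varsigma_r+q_r]dW_r$ for $s>t$ (up to time $t+\delta$ when only needed there), $\mathbb{P}$-a.s.; $X^{t,\mathbf{x};\beta,\varsigma}:=X^{t,\mathbf{x};\beta,\varsigma;0,0}$. $\mathbf{O}^t_{\varepsilon,\delta}$ is the set of $(p,q)\in\mathbb{L}^0(\mathbb{F}^t,\mathbb{R})^2$ with $\|\mathbf{1}_{\llbracket t,t+\delta\rrbracket}p\|^2_{\mathbb{L}^2(\mathbb{F}^t,\mathbb{P},\mathbb{R})}+\|\mathbf{1}_{\llbracket t,t+\delta\rrbracket}q\|^2_{\mathbb{L}^2(\mathbb{F}^t,\mathbb{P},\mathbb{R})}\le\varepsilon\delta$. For $a\in\mathcal{A}$, $(b,\sigma)(\cdot,\mathbf{x}_{\cdot\wedge t},a)$ is the process $s\mapsto(b,\sigma)(s,\mathbf{x}_{\cdot\wedge t},a_s)$, and $\mathcal{E}^a_+(t,\mathbf{x}):=\{(b,\sigma)(\cdot,\mathbf{x}_{\cdot\wedge t},a)\}$. Path derivatives. For $t\in[0,T)$,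 $C^{1,2}_b([t,T]\times\Omega)$ is the set of bounded continuous $\varphi:[t,T]\times\Omega\to\mathbb{R}$ for which there are bounded continuous $\partial_t\varphi,\partial_{\mathbf{x}}\varphi,\partial^2_{\mathbf{x}\mathbf{x}}\varphi:[t,T]\times\Omega\to\mathbb{R}$ such that for all $\mathbf{x}\in\Omega$, $(\beta,\varsigma)\in\mathbb{L}^2(\mathbb{F}^t,\mathbb{P},\mathbb{R})^2$ and $t\le t_1<t_2\le T$, with $X=X^{t,\mathbf{x};\beta,\varsigma}$, $\mathbb{P}$-a.s., $\varphi(t_2,X)-\varphi(t_1,X)=\int_{t_1}^{t_2}[\partial_t\varphi(s,X)+\beta_s\partial_{\mathbf{x}}\varphi(s,X)+\frac12\varsigma_s^2\partial^2_{\mathbf{x}\mathbf{x}}\varphi(s,X)]ds+\int_{t_1}^{t_2}\varsigma_s\partial_{\mathbf{x}}\varphi(s,X)dW_s$; these derivatives are uniquely determined. Operators. For $a\in A$, $\mathcal{L}^a\varphi(t,\mathbf{x}):=\partial_t\varphi(t,\mathbf{x})+b(t,\mathbf{x},a)\partial_{\mathbf{x}}\varphi(t,\mathbf{x})+\frac12\sigma^2(t,\mathbf{x},a)\partial^2_{\mathbf{x}\mathbf{x}}\varphi(t,\mathbf{x})$. For a control process $a\in\mathcal{A}$ and $\varphi\in C^{1,2}_b([t,T]\times\Omega)$, $\mathcal{L}^a\varphi(t,\mathbf{x}):=\inf_{\varepsilon>0}\sup\{\delta^{-1}\mathbb{E}[\int_t^{t+\delta}\mathcal{L}^{a(s)}\varphi(s,X^{p,q})ds]:\delta\in(0,\varepsilon\wedge(T-t)],(p,q)\in\mathbf{O}^t_{\varepsilon,\delta}\}$,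 where $X^{p,q}:=X^{t,\mathbf{x};\beta,\varsigma;p,q}$ with $(\beta,\varsigma)=(b,\sigma)(\cdot,\mathbf{x}_{\cdot\wedge t},a)$. Viscosity subsolution. For $(t,\mathbf{x})\in[0,T)\times\Omega$ and $\mathcal{E}\subset\mathbb{L}^2(\mathbb{F}^t,\mathbb{P},\mathbb{R})^2$, $\underline\Phi^{\mathcal{E}}u(t,\mathbf{x})$ is the set of $\varphi\in C^{1,2}_b([t,T]\times\Omega)$ for which there is $\varepsilon>0$ such that for all $\delta\in(0,\varepsilon]$ (with $t+\delta\le T$), $(\beta,\varsigma)\in\mathcal{E}$, $(p,q)\in\mathbf{O}^t_{\varepsilon,\delta}$: $0=(\varphi-u)(t,\mathbf{x})\le\mathbb{E}[(\varphi-u)(t+\delta,X^{t,\mathbf{x};\beta,\varsigma;p,q})]$. $u$ is a viscosity subsolution if $u$ is u.s.c. and bounded from above, $u(T,\cdot)\le h$, and $\mathcal{L}^a\varphi(t,\mathbf{x})\ge0$ for all $(t,\mathbf{x})\in[0,T)\times\Omega$, $a\in\mathcal{A}^t$ and $\varphi\in\underline\Phi^{\mathcal{E}^a_+(t,\mathbf{x})}u(t,\mathbf{x})$. Quasi-contingent subsolution. For $u$ bounded from above, $D^{1,2}_\downarrow u(t,\mathbf{x})(1,\beta,\varsigma):=\inf_{\varepsilon>0}\sup\{\mathbb{E}[\delta^{-1}(u(t+\delta,X^{t,\mathbf{x};\beta,\varsigma;p,q})-u(t,\mathbf{x}))]:\delta\in(0,\varepsilon\wedge(T-t)],(p,q)\in\mathbf{O}^t_{\varepsilon,\delta}\}$.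 $u$ is a quasi-contingent subsolution if $u$ is u.s.c. and bounded from above, $u(T,\cdot)\le h$, and $\inf_{a\in\mathcal{A}^t}D^{1,2}_\downarrow u(t,\mathbf{x})(1,(b,\sigma)(\cdot,\mathbf{x}_{\cdot\wedge t},a))\ge0$ for all $(t,\mathbf{x})\in[0,T)\times\Omega$. *)

(* Defs.v *)
From HB Require Import structures.
From mathcomp Require Import all_boot all_order all_algebra.
From mathcomp Require Import all_classical all_reals all_analysis.

Set Implicit Arguments.
Unset Strict Implicit.
Unset Printing Implicit Defensive.

Import Order.TTheory GRing.Theory Num.Theory.
Import numFieldNormedType.Exports.

Local Open Scope classical_set_scope.
Local Open Scope ring_scope.

(* The path space Omega = C(R_+, R). A path is stored as its unique extension  *)
(* to R that is constant on ]-oo, 0], so that Leibniz equality of paths is     *)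
(* equality on R_+. Times are real numbers, and every definition below         *)
(* constrains processes and functions of (time, path) at times >= 0 only.      *)
Record path_space (R : realType) := PathSpace {
  path_fun :> R -> R ;
  path_funP : continuous path_fun /\ forall s, s <= 0 -> path_fun s = path_fun 0
}.

Section path_space_structures.
Context (R : realType).

Lemma stop_subproof (t : R) (x : path_space R) :
  continuous (fun s => x (Num.min s t)) /\
  forall s, s <= 0 -> x (Num.min s t) = x (Num.min 0 t).
Proof.
have [cx x0] := path_funP x; split.
- move=> s; apply: (@continuous_comp _ _ _ (fun r : R => Num.min r t) x).
    by apply: continuous_min; [exact: cvg_id | exact: cvg_cst].
  exact: cx.
- move=> s s0; have [t0|t0] := leP 0 t.
    by rewrite (min_idPl (le_trans s0 t0)) x0.
  rewrite (x0 (Num.min s t)) ?ge_min ?s0//.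
  by rewrite (x0 t)// ltW.
Qed.

(* The stopped path x_{. /\ t}. *)
Definition stop (t : R) (x : path_space R) : path_space R :=
  PathSpace (stop_subproof t x).

Lemma path_zero_subproof :
  continuous (fun _ : R => 0 : R) /\ forall s : R, s <= 0 -> 0 = 0 :> R.
Proof. by split=> // s; exact: cvg_cst. Qed.

HB.instance Definition _ := gen_eqMixin (path_space R).
HB.instance Definition _ := gen_choiceMixin (path_space R).
HB.instance Definition _ :=
  isPointed.Build (path_space R) (PathSpace path_zero_subproof).

Definition path_to_family (x : path_space R) : {family compact, R -> R} :=
  path_fun x.

(* Locally uniform convergence, and its Borel sigma-algebra. *)
HB.instance Definition _ :=
  Topological.copy (path_space R) (initial_topology path_to_family).

HB.instance Definition _ := Measurable.copy (path_space R)
  (g_sigma_algebraType (@open (path_space R))).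

End path_space_structures.

Section path_pseudometric.
Context (R : realType).
Local Notation Omega := (path_space R).

Definition supnorm (f : R -> R) : R := sup [set `|f r| | r in `[0, +oo[].

Definition path_dist (s : R) (x : Omega) (s' : R) (x' : Omega) : R :=
  `|s - s'| + supnorm (fun r => stop s x r - stop s' x' r).

(* Upper semicontinuity and continuity on [t0, t1] x Omega. *)
Definition path_usc (t0 t1 : R) (f : R -> Omega -> R) : Prop :=
  forall s x, t0 <= s <= t1 -> forall c, f s x < c ->
  exists2 eta, 0 < eta & forall s' x', t0 <= s' <= t1 ->
    path_dist s x s' x' < eta -> f s' x' < c.

Definition path_continuous (t0 t1 : R) (f : R -> Omega -> R) : Prop :=
  forall s x, t0 <= s <= t1 -> forall e, 0 < e ->
  exists2 eta, 0 < eta & forall s' x', t0 <= s' <= t1 ->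
    path_dist s x s' x' < eta -> `|f s x - f s' x'| < e.

Definition path_bounded (t0 t1 : R) (f : R -> Omega -> R) : Prop :=
  exists M, forall s x, t0 <= s <= t1 -> `|f s x| <= M.

Definition bounded_from_above (t0 t1 : R) (f : R -> Omega -> R) : Prop :=
  exists M, forall s x, t0 <= s <= t1 -> f s x <= M.

End path_pseudometric.

Section filtrations.
Context (R : realType).
Local Notation Omega := (path_space R).
Local Notation process := (R -> Omega -> R).

Definition measurable_wrt (S : Type) (D : set S) (G : set (set S)) (f : S -> R) :=
  forall B : set R, measurable B -> G (D `&` f @^-1` B).

(* F_s = sigma(W_r : 0 <= r <= s), W being the canonical process W_r(w) = w r. *)
Definition filtF (s : R) : set (set Omega) :=
  <<s [set E | exists r (B : set R), [/\ 0 <= r <= s, measurable B &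
         E = [set w : Omega | B (w r)]]] >>.

(* F^t_s = sigma(W_r - W_t : t <= r <= s); for s < t there are no generators   *)
(* and this is the trivial sigma-algebra.                                      *)
Definition filtFt (t s : R) : set (set Omega) :=
  <<s [set E | exists r (B : set R), [/\ t <= r <= s, measurable B &
         E = [set w : Omega | B (w r - w t)]]] >>.

Definition time_path : set (R * Omega) := `[0, +oo[ `*` setT.

Definition progressive (F : R -> set (set Omega)) (X : process) : Prop :=
  forall s, 0 <= s ->
  measurable_wrt (`[0, s] `*` setT)
    <<s `[0, s] `*` setT, [set E | exists (C : set R) B,
        [/\ measurable C, C `<=` `[0, s], F s B & E = C `*` B]] >>
    (fun z => X z.1 z.2).

(* The predictable sigma-algebra on R_+ x Omega. *)
Definition predictable_sets (F : R -> set (set Omega)) : set (set (R * Omega)) :=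
  <<s time_path, [set E | (exists2 B, F 0 B & E = [set 0] `*` B) \/
     (exists r s B, [/\ 0 <= r <= s, F r B & E = `]r, s] `*` B])] >>.

Definition predictable (F : R -> set (set Omega)) (X : process) : Prop :=
  measurable_wrt time_path (predictable_sets F) (fun z => X z.1 z.2).

End filtrations.

Section wiener_ito.
Context (R : realType).
Local Notation Omega := (path_space R).
Local Notation process := (R -> Omega -> R).
Local Notation leb := (@lebesgue_measure R).
Context (P : probability Omega R).

Definition wiener_measure : Prop :=
  [/\ P [set w : Omega | w 0 = 0] = 1%E,
      forall r s (B : set R), 0 <= r < s -> measurable B ->
        P [set w : Omega | B (w s - w r)] = normal_prob 0 (Num.sqrt (s - r)) B
    & forall r s (B : set R) (E : set Omega), 0 <= r < s -> measurable B ->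
        filtF r E ->
        P (E `&` [set w : Omega | B (w s - w r)]) = (P E * P [set w : Omega | B (w s - w r)%R])%E].

(* \sum_(i < n) xi_i 1_{]tau_i, tau_(i+1)]} with bounded, F_(tau_i)-measurable *)
(* xi_i and t1 = tau_0 <= ... <= tau_n = t2.                                   *)
Record elementary := Elementary {
  elem_size : nat ;
  elem_time : nat -> R ;
  elem_coef : nat -> Omega -> R
}.

Definition elementary_on (t1 t2 : R) (e : elementary) : Prop :=
  [/\ elem_time e 0%N = t1, elem_time e (elem_size e) = t2
    & forall i, (i < elem_size e)%N ->
      [/\ elem_time e i <= elem_time e i.+1,
          measurable_wrt setT (filtF (elem_time e i)) (elem_coef e i)
        & exists M, forall w, `|elem_coef e i w| <= M]].

Definition elementary_process (e : elementary) : process := fun s w =>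
  \sum_(i < elem_size e)
     elem_coef e i w * \1_(`]elem_time e i, elem_time e i.+1]) s.

Definition elementary_integral (e : elementary) (w : Omega) : R :=
  \sum_(i < elem_size e)
     elem_coef e i w * (w (elem_time e i.+1) - w (elem_time e i)).

(* I is (a version of) the Ito integral of H over [t1, t2], H being in the     *)
(* L^2-closure of the elementary F-adapted processes.                          *)
Definition ito_integral (t1 t2 : R) (H : process) (I : Omega -> R) : Prop :=
  [/\ measurable_fun (`[t1, t2] `*` setT) (fun z : R * Omega => H z.1 z.2),
      measurable_fun setT I
    & exists e : nat -> elementary, [/\
        forall n, elementary_on t1 t2 (e n),
        (fun n => (\int[P]_w \int[leb]_(s in `[t1, t2])
           ((elementary_process (e n) s w - H s w) ^+ 2)%R%:E)%E)
             @ \oo --> 0%E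
      & (fun n => (\int[P]_w
           ((elementary_integral (e n) w - I w) ^+ 2)%R%:E)%E)
             @ \oo --> 0%E]].

(* M is a continuous version of s |-> \int_t^s H dW on ]t, theta]. *)
Definition ito_process (t : R) (theta : \bar R) (H : process)
    (M : Omega -> Omega) : Prop :=
  measurable_fun setT M /\
  forall s, t < s -> (s%:E <= theta)%E -> ito_integral t s H (fun w => M w s).

(* X is (a version of) X^{t,x;beta,vs;p,q} up to time theta. Nothing is        *)
(* required of X after theta.                                                  *)
Definition controlled_path (t : R) (x : Omega) (beta vs p q : process)
    (theta : \bar R) (X : Omega -> Omega) : Prop :=
  measurable_fun setT X /\
  exists2 M, ito_process t theta (fun r w => vs r w + q r w) M &
    {ae P, forall w,
      (forall s, 0 <= s <= t -> X w s = x s) /\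
      (forall s, t < s -> (s%:E <= theta)%E ->
        X w s = x t + \int[leb]_(r in `[t, s]) (beta r w + p r w) + M w s)}.

Definition L2sqnorm (t : R) (X : process) : \bar R :=
  (\int[P]_w \int[leb]_(s in `[t, +oo[) (`|X s w| ^+ 2)%R%:E)%E.

Definition L2 (t : R) (X : process) : Prop :=
  progressive (filtFt t) X /\ (L2sqnorm t X < +oo)%E.

(* Pairs in L2(F^t)^2, with the convention fixing their values on [[0, t]].    *)
Definition L2pair (p0 q0 : R) (t : R) (bv : process * process) : Prop :=
  [/\ L2 t bv.1, L2 t bv.2
    & forall s w, 0 <= s <= t -> bv.1 s w = p0 /\ bv.2 s w = q0].

Definition Oset (t eps delta : R) (p q : process) : Prop :=
  [/\ progressive (filtFt t) p, progressive (filtFt t) q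
    & (L2sqnorm t (fun s w => \1_(`[t, t + delta]) s * p s w)%R
       + L2sqnorm t (fun s w => \1_(`[t, t + delta]) s * q s w)%R
       <= (eps * delta)%R%:E)%E].

Definition zero_process : process := fun _ _ => 0.

Definition path_derivatives (T p0 q0 t : R) (phi phit phix phixx : process) :
    Prop :=
  [/\ path_bounded t T phi /\ path_continuous t T phi,
      path_bounded t T phit /\ path_continuous t T phit,
      path_bounded t T phix /\ path_continuous t T phix,
      path_bounded t T phixx /\ path_continuous t T phixx
    & forall (x : Omega) (beta vs : process) (t1 t2 : R) (X : Omega -> Omega),
        L2pair p0 q0 t (beta, vs) -> t <= t1 -> t1 < t2 -> t2 <= T ->
        controlled_path t x beta vs zero_process zero_process +oo%E X ->
        exists2 I,
          ito_integral t1 t2 (fun s w => vs s w * phix s (X w)) I &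
          {ae P, forall w, phi t2 (X w) - phi t1 (X w) =
            \int[leb]_(s in `[t1, t2])
              (phit s (X w) + beta s w * phix s (X w)
               + 2^-1 * vs s w ^+ 2 * phixx s (X w)) + I w}].

Definition C12b (T p0 q0 t : R) (phi : process) : Prop :=
  exists phit phix phixx, path_derivatives T p0 q0 t phi phit phix phixx.

End wiener_ito.

Section terminal_value_problem.
Context (R : realType).
Local Notation Omega := (path_space R).
Local Notation process := (R -> Omega -> R).
Local Notation leb := (@lebesgue_measure R).

Definition control_set (A : set R) : Prop := measurable A /\ A `<=` `[0, 1].

Definition data_domain (A : set R) : set (R * Omega * R) :=
  `[0, +oo[ `*` setT `*` A.

Definition assumption_A1 (T : R) (A : set R) (b sigma : R -> Omega -> R -> R)
    (h : Omega -> R) : Prop :=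
  [/\ measurable_wrt setT (filtF T) h,
      measurable_fun (data_domain A)
        (fun z : R * Omega * R => b z.1.1 z.1.2 z.2),
      measurable_fun (data_domain A)
        (fun z : R * Omega * R => sigma z.1.1 z.1.2 z.2),
      forall t x a, 0 <= t -> A a ->
        b t x a = \1_(`[0, T]) t * b t (stop t x) a /\
        sigma t x a = \1_(`[0, T]) t * sigma t (stop t x) a
    & forall x, h x = h (stop T x)].

Definition assumption_A2 (A : set R) (b sigma : R -> Omega -> R -> R)
    (h : Omega -> R) : Prop :=
  exists2 Lb : R, 1 <= Lb & forall t x x' a, 0 <= t -> A a ->
    `|b t x a - b t x' a| + `|sigma t x a - sigma t x' a|
      <= Lb * supnorm (fun r => stop t x r - stop t x' r) /\
    `|b t x a| + `|sigma t x a| + `|h x| <= Lb.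

Definition control (A : set R) (a : process) : Prop :=
  predictable (@filtF R) a /\ forall s w, 0 <= s -> A (a s w).

Definition control_from (A : set R) (a0 t : R) (a : process) : Prop :=
  [/\ control A a, predictable (filtFt t) a
    & forall s w, 0 <= s <= t -> a s w = a0].

(* The process s |-> c(s, x_{. /\ t}, a_s); its value c0 on [[0, t]] is the    *)
(* convention on elements of L2(F^t)^2.                                        *)
Definition coef_process (c : R -> Omega -> R -> R) (c0 t : R) (x : Omega)
    (a : process) : process :=
  fun s w => if s <= t then c0 else c s (stop t x) (a s w).

Context (P : probability Omega R) (T p0 q0 : R).

Definition E_plus (b sigma : R -> Omega -> R -> R) (t : R) (x : Omega)
    (a : process) : set (process * process) :=
  [set (coef_process b p0 t x a, coef_process sigma q0 t x a)].

(* L^a phi (s, x) for a in A; the arguments phit, phix, phixx are the path     *)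
(* derivatives of phi.                                                         *)
Definition generator (b sigma : R -> Omega -> R -> R)
    (phit phix phixx : process) (a s : R) (x : Omega) : R :=
  phit s x + b s x a * phix s x + 2^-1 * sigma s x a ^+ 2 * phixx s x.

(* L^a phi (t, x) for a control process a. *)
Definition control_generator (b sigma : R -> Omega -> R -> R)
    (phit phix phixx : process) (a : process) (t : R) (x : Omega) : \bar R :=
  ereal_inf [set ereal_sup [set v : \bar R |
      exists (delta : R) (p q : process) (X : Omega -> Omega),
      [/\ 0 < delta <= Num.min eps (T - t), Oset P t eps delta p q,
          controlled_path P t x (coef_process b p0 t x a)
            (coef_process sigma q0 t x a) p q (t + delta)%:E X
        & v = (delta^-1%:E * \int[P]_w \int[leb]_(s in `[t, (t + delta)%R])
               (generator b sigma phit phix phixx (a s w) s (X w))%:E)%E]]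
    | eps in [set eps : R | 0 < eps]].

Definition under_test (E : set (process * process)) (u : process) (t : R)
    (x : Omega) : set process :=
  [set phi | C12b P T p0 q0 t phi /\
    exists2 eps : R, 0 < eps &
    forall (delta : R) (beta vs p q : process),
      0 < delta <= eps -> t + delta <= T -> E (beta, vs) ->
      Oset P t eps delta p q ->
      0 = phi t x - u t x /\
      forall X, controlled_path P t x beta vs p q (t + delta)%:E X ->
        (0 <= \int[P]_w (phi (t + delta)%R (X w) - u (t + delta)%R (X w))%R%:E)%E].

(* The path derivatives of a test function being unique, quantifying over all  *)
(* of them amounts to taking the derivatives of phi.                           *)
Definition viscosity_subsolution (A : set R) (a0 : R)
    (b sigma : R -> Omega -> R -> R) (h : Omega -> R) (u : process) : Prop :=
  [/\ path_usc 0 T u, bounded_from_above 0 T u,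
      forall x, u T x <= h x
    & forall t x a phi phit phix phixx, 0 <= t < T -> control_from A a0 t a ->
        under_test (E_plus b sigma t x a) u t x phi ->
        path_derivatives P T p0 q0 t phi phit phix phixx ->
        (0 <= control_generator b sigma phit phix phixx a t x)%E].

(* D^{1,2}_down u(t, x)(1, beta, vs) *)
Definition D12_down (u : process) (t : R) (x : Omega) (beta vs : process) :
    \bar R :=
  ereal_inf [set ereal_sup [set v : \bar R |
      exists (delta : R) (p q : process) (X : Omega -> Omega),
      [/\ 0 < delta <= Num.min eps (T - t), Oset P t eps delta p q,
          controlled_path P t x beta vs p q (t + delta)%:E X
        & v = (\int[P]_w (delta^-1 * (u (t + delta)%R (X w) - u t x))%R%:E)%E]]
    | eps in [set eps : R | 0 < eps]].

Definition quasi_contingent_subsolution (A : set R) (a0 : R)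
    (b sigma : R -> Omega -> R -> R) (h : Omega -> R) (u : process) : Prop :=
  [/\ path_usc 0 T u, bounded_from_above 0 T u,
      forall x, u T x <= h x
    & forall t x, 0 <= t < T ->
        (0 <= ereal_inf [set D12_down u t x (coef_process b p0 t x a)
                 (coef_process sigma q0 t x a) | a in control_from A a0 t])%E].

End terminal_value_problem.

(* Main.v *)
Require Import Defs.
From HB Require Import structures.
From mathcomp Require Import all_boot all_order all_algebra.
From mathcomp Require Import all_classical all_reals all_analysis.
From mathcomp Require Import measurable_realfun lra ring.
Import Order.TTheory GRing.Theory Num.Theory.
Import numFieldNormedType.Exports.
Local Open Scope classical_set_scope.
Local Open Scope ring_scope.

(* If the quasi-contingent derivative at (t, x) were negative, say at most -c   *)
(* for some eps, then phi(s, y) := u(t, x) - c (s - t) would be a test function *)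
(* for u at (t, x) whose generator is -c < 0, contradicting the viscosity       *)
(* property.                                                                    *)

(** The contradiction needs only a test function that is affine in time and blind to the path. Its
    path derivatives are the constants [- c], [0], [0], so its Ito formula is deterministic
    ([path_derivatives_affine]). Being a test function for [u] is then the bound [- c] on the
    expected difference quotients of [u], rearranged ([integral_le_drift]). That lemma needs [u] at
    a fixed time to be measurable, which follows from upper semicontinuity ([usc_open],
    [usc_measurable]). *)

Lemma supnorm_ge0 (R : realType) (f : R -> R) : 0 <= supnorm f.
Proof.
rewrite /supnorm; set S := [set _ | _ in _].
(* For an unbounded [f], [sup] takes its default value 0. *)
have [[S0 ubS]|/sup_out -> //] := pselect (has_sup S).
apply: (@le_trans _ _ `|f 0|) => //; apply: ub_le_sup => //.
by exists 0 => //=; rewrite in_itv /= lexx.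
Qed.

Lemma supnorm_le (R : realType) (f : R -> R) (e : R) :
  (forall r, 0 <= r -> `|f r| <= e) -> supnorm f <= e.
Proof.
move=> fe; apply: ge_sup.
  by exists `|f 0|, 0 => //=; rewrite in_itv /= lexx.
by move=> _ [r + <-]; rewrite /= in_itv /= andbT; exact: fe.
Qed.

Lemma path_dist_ge_time (R : realType) (s s' : R) (x x' : path_space R) :
  `|s - s'| <= path_dist s x s' x'.
Proof. by rewrite lerDl supnorm_ge0. Qed.

(** Paths carry the topology of uniform convergence on compacts, and [[0, s]] is compact. *)
Lemma path_space_nbhs (R : realType) (s e : R) (x : path_space R) : 0 < e ->
  nbhs x [set y : path_space R | forall r, 0 <= r <= s -> `|x r - y r| < e].
Proof.
move=> e0.
have cont : continuous (@path_to_family R) := @initial_continuous _ _ _.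
have xN := @fam_nbhs R R compact `[0, s] _ (path_to_family x)
  (entourage_ball R (PosNum e0)) (@segment_compact R 0 s).
apply: (@filterS _ (nbhs x) (nbhs_filter x) _ _ _ (cont x _ xN)).
move=> y /= xy r rs.
by apply: xy; rewrite /= in_itv.
Qed.

(** At equal times [s], [path_dist] sees the paths only on [[0, s]], so locally uniform
    neighbourhoods are fine enough for it. *)
Lemma usc_open (R : realType) (t0 t1 : R) (u : R -> path_space R -> R) :
  path_usc t0 t1 u -> forall s c, t0 <= s <= t1 -> 0 <= s ->
  open [set y | u s y < c].
Proof.
move=> uscu s c st s0; rewrite openE => x /= /(uscu s x st)[eta eta0 ux].
have eta2 : 0 < eta / 2 by rewrite divr_gt0.
have xN := @path_space_nbhs R s _ x eta2.
apply: (@filterS _ (nbhs x) (nbhs_filter x) _ _ _ xN).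
move=> y /= xy; apply: ux => //.
rewrite /path_dist subrr normr0 add0r.
rewrite (@le_lt_trans _ _ (eta / 2))//; last by lra.
apply: supnorm_le => r r0 /=; apply/ltW/xy.
by rewrite le_min r0 s0 ge_min lexx orbT.
Qed.

Lemma usc_measurable (R : realType) (t0 t1 : R) (u : R -> path_space R -> R) :
  path_usc t0 t1 u -> forall s, t0 <= s <= t1 -> 0 <= s ->
  measurable_fun setT (u s).
Proof.
move=> uscu s st s0.
apply: (measurability (@RGenInftyO.G R)).
  exact: RGenInftyO.measurableE.
move=> _ [_ [c ->] <-]; rewrite setTI.
apply: sub_sigma_algebra; rewrite (_ : _ @^-1` _ = [set y | u s y < c]).
  exact: usc_open uscu _ _ st s0.
by apply/seteqP; split => y /=; rewrite in_itv.
Qed.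

(* The first integral may be -oo; since f is only bounded above, linearity is   *)
(* used after showing that a negative second integral forces integrability.     *)
Lemma integral_le_drift (d : measure_display) (Om : measurableType d)
    (R : realType) (P : probability Om R) (f : Om -> R) (k c delta M : R) :
  measurable_fun setT f -> (forall w, f w <= M) -> 0 < delta ->
  (\int[P]_w (delta^-1 * (f w - k))%:E <= (- c)%:E)%E ->
  (0 <= \int[P]_w (k - c * delta - f w)%:E)%E.
Proof.
move=> mf fM delta0.
set h := fun w => k - c * delta - f w.
have mh : measurable_fun setT h by exact: measurable_funB.
move=> gc; rewrite leNgt; apply/negP => h0; move: gc; apply/negP; rewrite -ltNge.
have hfin : (\int[P]_w (h w)%:E)%E \is a fin_num.
  rewrite fin_numElt (lt_trans h0) ?ltry// andbT.
  (* Since [f] is at most [M], [h] is bounded below and its negative part has finite integral; [h0]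
     excludes the value +oo. *)
  have hneg : (\int[P]_w ((EFin \o h)^\- w) <= `|M - (k - c * delta)|%:E)%E.
    rewrite -[leRHS]mule1 -(@probability_setT _ _ _ P).
    rewrite -integral_cst//; apply: ge0_le_integral => //.
      exact/measurable_funeneg/measurable_EFinP.
    move=> w _; rewrite funenegE /= ge_max !lee_fin normr_ge0 andbT.
    by rewrite (le_trans _ (ler_norm _))// /h opprB lerB.
  rewrite integralE ltNye adde_eq_ninfty negb_or eqe_oppLR /=.
  rewrite -ltNye (@lt_le_trans _ _ 0%E) ?ltNy0 ?integral_ge0//=.
  by rewrite -ltey (le_lt_trans hneg) ?ltry.
have ih : P.-integrable setT (EFin \o h).
  apply/integrableP; split; first exact/measurable_EFinP.
  by rewrite (@integral_fin_num_abs _ _ _ P setT h)//.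
have := finite_measure_integrable_cst P (- c) => /(_ setT measurableT) ic.
under eq_integral => w _.
  (* A negative integral of [h] thus pushes the mean quotient strictly above [- c]. *)
  rewrite (_ : delta^-1 * (f w - k) = - c - delta^-1 * h w); last first.
    by rewrite /h; field; lra.
  rewrite EFinB EFinM; over.
rewrite integralB//=; last exact: (integrableZl measurableT _ ih).
rewrite integralZl//= integral_cst//= probability_setT mule1.
move: h0; rewrite -(fineK hfin) lte_fin => h0.
by rewrite -EFinM -EFinB lte_fin ltrBrDr gtrDl pmulr_rlt0 ?invr_gt0.
Qed.

Lemma ito_integral0 (R : realType) (P : probability (path_space R) R)
    (t1 t2 : R) : t1 <= t2 ->
  ito_integral P t1 t2 (fun _ _ => 0) (fun _ => 0).
Proof.
move=> t12; split; [exact: measurable_cst..|].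
(* One interval with coefficient 0: the partition must still run from [t1] to [t2]. *)
pose e : elementary R :=
  Elementary 1 (fun n => if n is 0 then t1 else t2) (fun _ _ => 0).
exists (fun _ => e); split.
- move=> _; split=> // -[|//] _; split=> //=.
    2: by exists 0 => w; rewrite normr0.
  exact: (@measurable_cst _ _ (g_sigma_algebraType _) R setT 0 measurableT).
- rewrite (_ : (fun _ => _) = cst 0%E); first exact: cvg_cst.
  apply/funext => n /=; rewrite integral0_eq// => w _; rewrite integral0_eq// => s _.
  by rewrite /elementary_process big_ord1 /= mul0r subrr expr0n.
- rewrite (_ : (fun _ => _) = cst 0%E); first exact: cvg_cst.
  apply/funext => n /=; rewrite integral0_eq// => w _.
  by rewrite /elementary_integral big_ord1 /= mul0r subrr expr0n.
Qed.

Lemma path_derivatives_affine (R : realType) (P : probability (path_space R) R)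
    (T p0 q0 t k c : R) :
  path_derivatives P T p0 q0 t (fun s _ => k - c * (s - t))
    (fun _ _ => - c) (fun _ _ => 0) (fun _ _ => 0).
Proof.
have cst_ok a : path_bounded t T (fun _ (_ : path_space R) => a) /\
    path_continuous t T (fun _ (_ : path_space R) => a).
  split; first by exists `|a|.
  by move=> s x st e e0; exists 1 => // s' x' _ _; rewrite subrr normr0.
split=> //.
  split.
    exists (`|k| + `|c| * (T - t)) => s x /andP[ts sT].
    rewrite (le_trans (ler_normB _ _))// lerD2l normrM ler_wpM2l//.
    by rewrite ger0_norm ?subr_ge0// lerB.
  (* Adding 1 keeps the denominator positive when [c] is 0. *)
  move=> s x st e e0; exists (e / (`|c| + 1)).
    by rewrite divr_gt0// ltr_wpDl.
  move=> s' x' _ /(le_lt_trans (path_dist_ge_time _ _ _ _ _)) ss.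
  rewrite (_ : _ - _ = c * (s' - s)); last by ring.
  rewrite normrM distrC (@le_lt_trans _ _ ((`|c| + 1) * `|s - s'|))//.
    by rewrite ler_wpM2r// lerDl.
  by rewrite mulrC -ltr_pdivlMr// ltr_wpDl.
move=> x beta vs t1 t2 X _ _ t12 _ _; exists (fun _ => 0).
  rewrite (_ : (fun _ _ => _) = (fun _ _ => 0)); first exact/ito_integral0/ltW.
  by apply/funext => s; apply/funext => w; rewrite mulr0.
apply/aeW => w /=; rewrite addr0.
rewrite (_ : (fun s => _) = cst (- c)); last first.
  by apply/funext => s /=; rewrite !mulr0 !addr0.
rewrite Rintegral_cst//= lebesgue_measure_itv /= lte_fin t12 /=.
by ring.
Qed.

Theorem theorem6p10 (R : realType) (P : probability (path_space R) R)
  (hP : wiener_measure P)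
  (T : R) (hT : 0 < T)
  (A : set R) (hA : control_set A)
  (a0 p0 q0 : R) (ha0 : A a0)
  (b sigma : R -> path_space R -> R -> R) (h : path_space R -> R)
  (hA1 : assumption_A1 T A b sigma h) (hA2 : assumption_A2 A b sigma h)
  (u : R -> path_space R -> R)
  (hu : viscosity_subsolution P T p0 q0 A a0 b sigma h u) :
  quasi_contingent_subsolution P T p0 q0 A a0 b sigma h u.
Proof.
have [uscu [M uM] uT visc] := hu.
split=> //; first by exists M.
move=> t x /andP[t0 tT]; apply: le_ereal_inf_tmp => _ [a ca <-].
rewrite leNgt; apply/negP => /ereal_inf_lt[_ [eps /= eps0 <-]].
set S := ereal_sup _ => S0.
(* The supremum may be -oo; any positive slope then works. *)
have [c c0 Sc] : exists2 c : R, 0 < c & (S <= (- c)%:E)%E.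
  move: S S0 => [r||]//; last by exists 1 => //; rewrite leNye.
  by rewrite lte_fin => r0; exists (- r); rewrite ?oppr_gt0// opprK.
pose phi : R -> path_space R -> R := fun s _ => u t x - c * (s - t).
have dphi := path_derivatives_affine _ P T p0 q0 t (u t x) c.
have : under_test P T p0 q0 (E_plus p0 q0 b sigma t x a) u t x phi.
  split; first by do 3 eexists; exact: dphi.
  (* The [eps] defining [S] is reused, so each admissible [delta], [p], [q], [X] already competes in
     that supremum. *)
  exists eps => // delta beta vs p q /andP[d0 de] dT [-> ->] Opq.
  split; first by rewrite /phi subrr mulr0 subr0 subrr.
  move=> X cX; have tdT : 0 <= t + delta <= T.
    by rewrite dT andbT addr_ge0// ltW.
  rewrite /phi addrAC subrr add0r.
  apply: (@integral_le_drift _ _ _ _ _ _ _ _ M) => //.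
  - apply: measurableT_comp; last by case: cX.
    by apply: (usc_measurable _ _ _ _ uscu) => //; case/andP: tdT.
  - by move=> w; exact: uM.
  apply: le_trans Sc; apply: ereal_sup_ubound.
  exists delta, p, q, X; split=> //.
  by rewrite d0 le_min de lerBrDl.
move=> /visc /(_ dphi); rewrite t0 tT => /(_ isT ca).
apply/negP; rewrite -ltNge.
apply: (@le_lt_trans _ _ (- c)%:E); last by rewrite lte_fin oppr_lt0.
(* Any radius would do: the generator of [phi] is identically [- c], so every time average equals
   [- c]. *)
apply: ge_ereal_inf; eexists; first by exists 1 => /=.
apply: ge_ereal_sup => _ [delta [p [q [X [/andP[d0 _] _ _ ->]]]]].
under eq_integral => w _.
  under eq_integral => s _.
    rewrite /generator !mulr0 !addr0; over.
  rewrite integral_cst//= lebesgue_measure_itv /= lte_fin ltrDl d0.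
  over.
rewrite integral_cst//= probability_setT mule1.
by rewrite -!EFinM lee_fin (addrC t) addrK mulrCA mulVf ?mulr1// gt_eqF.
Qed.
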